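(* Let $F$ be an algebraically closed field, and for $i=1,2$ let $D_i$ be a division algebra that is finite dimensional over its center $F_i$, with $F\subseteq F_i$. Suppose $D_1=F_1$ is commutative. Then $F_1\otimes_F D_2$ has no zero divisors. *)

(* Defs.v *)
From HB Require Import structures.
From mathcomp Require Import all_boot all_order all_algebra all_field.
From mathcomp Require Import boolp.

Set Implicit Arguments.
Unset Strict Implicit.
Unset Printing Implicit Defensive.

Import GRing.Theory.
Local Open Scope ring_scope.
Local Open Scope quotient_scope.

(* The S-module (or S-algebra) V regarded as an R-module (R-algebra) along    *)
(* the ring morphism i : R -> S: k *: v is i k *: v.                          *)
Definition restrict_scalars (R S : pzRingType) (i : {rmorphism R -> S})
  (V : Type) : Type := V.

Section RestrictLmodule.
Variables (R S : pzRingType) (i : {rmorphism R -> S}) (V : lmodType S).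
Local Notation W := (restrict_scalars i V).

HB.instance Definition _ := GRing.Zmodule.copy W V.

Definition restrict_scale (k : R) (v : W) : W := i k *: (v : V).

Fact restrict_scaleA a b (v : W) :
  restrict_scale a (restrict_scale b v) = restrict_scale (a * b) v.
Proof. by rewrite /restrict_scale scalerA rmorphM. Qed.

Fact restrict_scale1 : left_id 1 restrict_scale.
Proof. by move=> v; rewrite /restrict_scale rmorph1 scale1r. Qed.

Fact restrict_scaleDr : right_distributive restrict_scale +%R.
Proof. by move=> a u v; rewrite /restrict_scale scalerDr. Qed.

Fact restrict_scaleDl (v : W) :
  {morph restrict_scale^~ v : a b / a + b}.
Proof. by move=> a b; rewrite /restrict_scale rmorphD scalerDl. Qed.

HB.instance Definition _ := GRing.Zmodule_isLmodule.Build R W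
  restrict_scaleA restrict_scale1 restrict_scaleDr restrict_scaleDl.

Lemma restrict_scalarsE (k : R) (v : W) : k *: v = i k *: (v : V) :> V.
Proof. by []. Qed.

End RestrictLmodule.

Section RestrictAlgebra.
Variables (R S : pzRingType) (i : {rmorphism R -> S}) (A : algType S).
Local Notation W := (restrict_scalars i A).

HB.instance Definition _ := GRing.NzRing.copy W A.

Fact restrict_scaleAl (k : R) (u v : W) : k *: (u * v) = (k *: u) * v.
Proof. by rewrite !restrict_scalarsE; exact: scalerAl. Qed.
HB.instance Definition _ := GRing.Lmodule_isLalgebra.Build R W restrict_scaleAl.

Fact restrict_scaleAr (k : R) (u v : W) : k *: (u * v) = u * (k *: v).
Proof. by rewrite !restrict_scalarsE; exact: scalerAr. Qed.
HB.instance Definition _ := GRing.Lalgebra_isAlgebra.Build R W restrict_scaleAr.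

End RestrictAlgebra.

(* Tensor product over a commutative ring.  A sequence of pairs stands for a  *)
(* formal sum of pure tensors; no formal opposites are needed because         *)
(* (- a, b) is an opposite of (a, b) modulo the relations.                    *)
Section Tensor.
Variables (R : comPzRingType) (A B : lmodType R).
Implicit Types (s t u : seq (A * B)) (p q : A * B) (a : A) (b : B) (k : R).

Inductive tensor_rel : seq (A * B) -> seq (A * B) -> Prop :=
| tensor_rel_refl s : tensor_rel s s
| tensor_rel_sym s t : tensor_rel s t -> tensor_rel t s
| tensor_rel_trans s t u : tensor_rel s t -> tensor_rel t u -> tensor_rel s u
| tensor_rel_cons p s t : tensor_rel s t -> tensor_rel (p :: s) (p :: t)
| tensor_rel_swap p q s : tensor_rel (p :: q :: s) (q :: p :: s)
| tensor_rel_0l b s : tensor_rel ((0, b) :: s) s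
| tensor_rel_Dl a a' b s :
    tensor_rel ((a + a', b) :: s) ((a, b) :: (a', b) :: s)
| tensor_rel_Dr a b b' s :
    tensor_rel ((a, b + b') :: s) ((a, b) :: (a, b') :: s)
| tensor_rel_Z k a b s :
    tensor_rel ((k *: a, b) :: s) ((a, k *: b) :: s).

Definition tensor_relb s t : bool := `[< tensor_rel s t >].

Fact tensor_relb_refl : reflexive tensor_relb.
Proof. by move=> s; apply/asboolP; exact: tensor_rel_refl. Qed.

Fact tensor_relb_sym : symmetric tensor_relb.
Proof. by move=> s t; apply/asboolP/asboolP; exact: tensor_rel_sym. Qed.

Fact tensor_relb_trans : transitive tensor_relb.
Proof.
move=> t s u /asboolP st /asboolP tu; apply/asboolP.
exact: tensor_rel_trans st tu.
Qed.

Canonical tensor_equiv :=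
  EquivRel tensor_relb tensor_relb_refl tensor_relb_sym tensor_relb_trans.

Definition tensor := {eq_quot tensor_relb}.

HB.instance Definition _ := Choice.on tensor.
HB.instance Definition _ := EqQuotient.on tensor.

Lemma tensorP s t : \pi_tensor s = \pi_tensor t <-> tensor_rel s t.
Proof. by split=> [/eqmodP/asboolP//|st]; apply/eqmodP/asboolP. Qed.

Lemma tensor_rel_catl s t u : tensor_rel s t -> tensor_rel (u ++ s) (u ++ t).
Proof. by move=> st; elim: u => //= p u IH; exact: tensor_rel_cons. Qed.

Lemma tensor_rel_catC s t : tensor_rel (s ++ t) (t ++ s).
Proof.
have mid p v w : tensor_rel (v ++ p :: w) (p :: v ++ w).
  elim: v => [|q v IH] /=; first exact: tensor_rel_refl.
  apply: tensor_rel_trans (tensor_rel_swap _ _ _).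
  exact: tensor_rel_cons.
elim: s => [|p s IH] /=; first by rewrite cats0; exact: tensor_rel_refl.
apply: tensor_rel_trans (tensor_rel_sym (mid _ _ _)).
exact: tensor_rel_cons.
Qed.

Lemma tensor_rel_cat s s' t t' :
  tensor_rel s s' -> tensor_rel t t' -> tensor_rel (s ++ t) (s' ++ t').
Proof.
move=> ss' tt'; apply: tensor_rel_trans (tensor_rel_catl s' tt').
apply: tensor_rel_trans (tensor_rel_catC _ _) _.
apply: tensor_rel_trans (tensor_rel_catC _ _).
exact: tensor_rel_catl.
Qed.

Lemma tensor_rel_0r a s : tensor_rel ((a, 0) :: s) s.
Proof.
rewrite -[0](scale0r (0 : B)).
apply: tensor_rel_trans (tensor_rel_sym (tensor_rel_Z _ _ _ _)) _.
by rewrite scale0r; exact: tensor_rel_0l.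
Qed.

Definition seq_opp s : seq (A * B) := [seq (- p.1, p.2) | p <- s].

Lemma tensor_rel_oppl s : tensor_rel (seq_opp s ++ s) [::].
Proof.
elim: s => [|[a b] s IH] /=; first exact: tensor_rel_refl.
apply: tensor_rel_trans (_ : tensor_rel ((- a, b) :: (a, b) :: seq_opp s ++ s) _).
  apply: tensor_rel_cons.
  apply: tensor_rel_trans (tensor_rel_catC _ _) _ => /=.
  by apply: tensor_rel_cons; exact: tensor_rel_catC.
apply: tensor_rel_trans (tensor_rel_sym (tensor_rel_Dl _ _ _ _)) _.
by rewrite addNr; apply: tensor_rel_trans (tensor_rel_0l _ _) _.
Qed.

Lemma tensor_rel_opp s t :
  tensor_rel s t -> tensor_rel (seq_opp s) (seq_opp t).
Proof.
elim=> [{}s|{}s {}t _|{}s {}t u _ st _|p {}s {}t _|p q {}s|b {}s|a a' b {}s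
  |a b b' {}s|k a b {}s] /=.
- exact: tensor_rel_refl.
- exact: tensor_rel_sym.
- exact: tensor_rel_trans.
- exact: tensor_rel_cons.
- exact: tensor_rel_swap.
- by rewrite oppr0; exact: tensor_rel_0l.
- by rewrite opprD; exact: tensor_rel_Dl.
- exact: tensor_rel_Dr.
- by rewrite -scalerN; exact: tensor_rel_Z.
Qed.

Definition tensor_zero : tensor := \pi_tensor [::].
Definition tensor_add (x y : tensor) : tensor := \pi_tensor (repr x ++ repr y).
Definition tensor_opp (x : tensor) : tensor := \pi_tensor (seq_opp (repr x)).

Lemma tensor_rel_repr s : tensor_rel (repr (\pi_tensor s)) s.
Proof. by apply/tensorP; rewrite reprK. Qed.

Lemma tensor_ind_pi (P : tensor -> Prop) :
  (forall s, P (\pi_tensor s)) -> forall x, P x.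
Proof. by move=> Ppi x; rewrite -(reprK x). Qed.

Lemma tensor_add_pi s t :
  tensor_add (\pi_tensor s) (\pi_tensor t) = \pi_tensor (s ++ t).
Proof. by apply/tensorP; apply: tensor_rel_cat; exact: tensor_rel_repr. Qed.

Lemma tensor_opp_pi s : tensor_opp (\pi_tensor s) = \pi_tensor (seq_opp s).
Proof. by apply/tensorP; apply: tensor_rel_opp; exact: tensor_rel_repr. Qed.

Fact tensor_addA : associative tensor_add.
Proof.
elim/tensor_ind_pi=> s; elim/tensor_ind_pi=> t; elim/tensor_ind_pi=> u.
by rewrite !tensor_add_pi catA.
Qed.

Fact tensor_addC : commutative tensor_add.
Proof. by move=> x y; apply/tensorP; exact: tensor_rel_catC. Qed.

Fact tensor_add0 : left_id tensor_zero tensor_add.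
Proof. by elim/tensor_ind_pi=> s; rewrite tensor_add_pi. Qed.

Fact tensor_addN : left_inverse tensor_zero tensor_opp tensor_add.
Proof.
elim/tensor_ind_pi=> s; rewrite tensor_opp_pi tensor_add_pi.
by apply/tensorP; exact: tensor_rel_oppl.
Qed.

HB.instance Definition _ := GRing.isZmodule.Build tensor
  tensor_addA tensor_addC tensor_add0 tensor_addN.

Definition tens a b : tensor := \pi_tensor [:: (a, b)].

Lemma tensor_piE s : \pi_tensor s = \sum_(p <- s) tens p.1 p.2.
Proof.
elim: s => [|[a b] s IH]; first by rewrite big_nil.
by rewrite big_cons -IH; apply/esym/(tensor_add_pi [:: (a, b)] s).
Qed.

Lemma tensor_spanned (x : tensor) :
  exists s : seq (A * B), x = \sum_(p <- s) tens p.1 p.2.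
Proof. by elim/tensor_ind_pi: x => s; exists s; exact: tensor_piE. Qed.

Lemma tensDl a a' b : tens (a + a') b = tens a b + tens a' b.
Proof.
by apply: etrans (esym (tensor_add_pi _ _)); apply/tensorP/tensor_rel_Dl.
Qed.

Lemma tensDr a b b' : tens a (b + b') = tens a b + tens a b'.
Proof.
by apply: etrans (esym (tensor_add_pi _ _)); apply/tensorP/tensor_rel_Dr.
Qed.

Lemma tensZ k a b : tens (k *: a) b = tens a (k *: b).
Proof. by apply/tensorP/tensor_rel_Z. Qed.

Lemma tensor_universal (V : zmodType) (f : A -> B -> V) :
    (forall a a' b, f (a + a') b = f a b + f a' b) ->
    (forall a b b', f a (b + b') = f a b + f a b') ->
    (forall k a b, f (k *: a) b = f a (k *: b)) ->
  exists g : {additive tensor -> V},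
    (forall a b, g (tens a b) = f a b) /\
    forall h : {additive tensor -> V},
      (forall a b, h (tens a b) = f a b) -> h =1 g.
Proof.
move=> fDl fDr fZ.
pose F s := \sum_(p <- s) f p.1 p.2.
have FE s t : tensor_rel s t -> F s = F t.
  rewrite /F; elim=> // {s t} => [s t u _ -> _ ->|p s t _ E|p q s|b s|a a' b s
    |a b b' s|k a b s] //; rewrite !big_cons /=.
  - by rewrite E.
  - by rewrite addrCA.
  - suff -> : f 0 b = 0 by rewrite add0r.
    by apply: (@addrI _ (f 0 b)); rewrite -fDl !addr0.
  - by rewrite fDl addrA.
  - by rewrite fDr addrA.
  - by rewrite fZ.
pose g (x : tensor) := F (repr x).
have gpi s : g (\pi_tensor s) = F s by apply: FE; exact: tensor_rel_repr.
have gB : zmod_morphism g.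
  move=> x y; apply/(@addIr _ (g y)); rewrite subrK.
  rewrite -[in RHS](subrK y x); move: (x - y) => {x} z.
  elim/tensor_ind_pi: z => s; elim/tensor_ind_pi: y => t.
  rewrite (_ : _ + _ = \pi_tensor (s ++ t)); last exact: tensor_add_pi.
  by rewrite !gpi /F big_cat.
pose gM := GRing.isZmodMorphism.Build _ _ g gB.
pose ga : {additive tensor -> V} := HB.pack g gM.
exists ga; split=> [a b|h hf]; first by rewrite /= gpi /F big_seq1.
elim/tensor_ind_pi=> s; rewrite /= gpi tensor_piE raddf_sum.
by apply: eq_bigr => p _; rewrite hf.
Qed.

End Tensor.

Arguments tensor R A B : clear implicits.

Section TensorAlgebra.
Variables (R : comPzRingType) (A B : algType R).
Implicit Types (s t u : seq (A * B)) (p q : A * B).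
Local Notation T := (tensor R A B).

Definition pair_mul p q : A * B := (p.1 * q.1, p.2 * q.2).
Definition seq_mul s t : seq (A * B) := [seq pair_mul p q | p <- s, q <- t].

Lemma tensor_rel_mulp p s t :
  tensor_rel s t -> tensor_rel (map (pair_mul p) s) (map (pair_mul p) t).
Proof.
elim=> {s t} [s|s t _|s t u _ st _|q s t _|q r s|b s|a a' b s
  |a b b' s|k a b s] /=; rewrite /pair_mul /=.
- exact: tensor_rel_refl.
- exact: tensor_rel_sym.
- exact: tensor_rel_trans.
- exact: tensor_rel_cons.
- exact: tensor_rel_swap.
- by rewrite mulr0; exact: tensor_rel_0l.
- by rewrite mulrDr; exact: tensor_rel_Dl.
- by rewrite mulrDr; exact: tensor_rel_Dr.
- by rewrite -!scalerAr; exact: tensor_rel_Z.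
Qed.

Lemma tensor_rel_pmul p s t :
  tensor_rel s t ->
  tensor_rel [seq pair_mul q p | q <- s] [seq pair_mul q p | q <- t].
Proof.
elim=> {s t} [s|s t _|s t u _ st _|q s t _|q r s|b s|a a' b s
  |a b b' s|k a b s] /=; rewrite /pair_mul /=.
- exact: tensor_rel_refl.
- exact: tensor_rel_sym.
- exact: tensor_rel_trans.
- exact: tensor_rel_cons.
- exact: tensor_rel_swap.
- by rewrite mul0r; exact: tensor_rel_0l.
- by rewrite mulrDl; exact: tensor_rel_Dl.
- by rewrite mulrDl; exact: tensor_rel_Dr.
- by rewrite -!scalerAl; exact: tensor_rel_Z.
Qed.

Definition tensor_one : T := tens 1 1.
Definition tensor_mul (x y : T) : T := \pi_T (seq_mul (repr x) (repr y)).

Lemma pi_seq_mul s t :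
  \pi_T (seq_mul s t) = \sum_(p <- s) \sum_(q <- t) tens (p.1 * q.1) (p.2 * q.2).
Proof.
rewrite tensor_piE /seq_mul big_allpairs_dep.
by apply: eq_bigr => p _; apply: eq_bigr.
Qed.

Lemma tensor_mul_pi s t :
  tensor_mul (\pi_T s) (\pi_T t) = \pi_T (seq_mul s t).
Proof.
have right s' t' t'' : tensor_rel t' t'' ->
    \pi_T (seq_mul s' t') = \pi_T (seq_mul s' t'').
  move=> tt; rewrite !pi_seq_mul; apply: eq_bigr => p _.
  have /tensorP := tensor_rel_mulp p tt.
  by rewrite !tensor_piE !big_map.
have left s' s'' t' : tensor_rel s' s'' ->
    \pi_T (seq_mul s' t') = \pi_T (seq_mul s'' t').
  move=> ss; rewrite !pi_seq_mul exchange_big [RHS]exchange_big.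
  apply: eq_bigr => p _; have /tensorP := tensor_rel_pmul p ss.
  by rewrite !tensor_piE !big_map.
rewrite /tensor_mul.
rewrite (left _ _ _ (tensor_rel_repr s)).
by rewrite (right _ _ _ (tensor_rel_repr t)).
Qed.

Fact tensor_mulDl : left_distributive tensor_mul +%R.
Proof.
elim/tensor_ind_pi=> s; elim/tensor_ind_pi=> t; elim/tensor_ind_pi=> u.
rewrite (_ : \pi_T s + \pi_T t = \pi_T (s ++ t)); last exact: tensor_add_pi.
by rewrite !tensor_mul_pi !pi_seq_mul big_cat.
Qed.

Fact tensor_mulDr : right_distributive tensor_mul +%R.
Proof.
elim/tensor_ind_pi=> s; elim/tensor_ind_pi=> t; elim/tensor_ind_pi=> u.
rewrite (_ : \pi_T t + \pi_T u = \pi_T (t ++ u)); last exact: tensor_add_pi.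
rewrite !tensor_mul_pi !pi_seq_mul -big_split; apply: eq_bigr => p _.
by rewrite big_cat.
Qed.

Lemma seq_mulA : associative seq_mul.
Proof.
move=> s t u; rewrite /seq_mul; elim: s => //= p s ->; rewrite allpairs_cat.
congr (_ ++ _); elim: t => //= q t IH; rewrite map_cat IH; congr (_ ++ _).
by rewrite -map_comp; apply: eq_map => r; rewrite /pair_mul /= !mulrA.
Qed.

Fact tensor_mulA : associative tensor_mul.
Proof.
elim/tensor_ind_pi=> s; elim/tensor_ind_pi=> t; elim/tensor_ind_pi=> u.
by rewrite !tensor_mul_pi seq_mulA.
Qed.

Fact tensor_mul1 : left_id tensor_one tensor_mul.
Proof.
elim/tensor_ind_pi=> s; rewrite tensor_mul_pi pi_seq_mul big_seq1 tensor_piE.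
by apply: eq_bigr => p _; rewrite !mul1r.
Qed.

Fact tensor_mulr1 : right_id tensor_one tensor_mul.
Proof.
elim/tensor_ind_pi=> s; rewrite tensor_mul_pi pi_seq_mul tensor_piE.
by apply: eq_bigr => p _; rewrite big_seq1 !mulr1.
Qed.

HB.instance Definition _ := GRing.Zmodule_isPzRing.Build T
  tensor_mulA tensor_mul1 tensor_mulr1 tensor_mulDl tensor_mulDr.

Lemma tensM (a a' : A) (b b' : B) :
  (tens a b : T) * tens a' b' = tens (a * a') (b * b').
Proof. exact: tensor_mul_pi. Qed.

Lemma tens11 : tens 1 1 = 1 :> T. Proof. by []. Qed.

End TensorAlgebra.

(* Main.v *)
Require Import Defs.
From HB Require Import structures.
From mathcomp Require Import all_boot all_order all_algebra all_field.
From mathcomp Require Import boolp.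

Set Implicit Arguments.
Unset Strict Implicit.
Unset Printing Implicit Defensive.

Import GRing.Theory.
Local Open Scope ring_scope.

(* A zero product in F1 (x) D2 is witnessed by finitely many elements of F1,  *)
(* and, F being algebraically closed, finitely many elements of F1 can be     *)
(* specialized to F with a prescribed nonzero element staying nonzero         *)
(* (Nullstellensatz, by adjoining one generator at a time). This carries the  *)
(* zero product to D2, which has no zero divisors; and when x and y are       *)
(* written with as few pure tensors as possible, their D2-components are      *)
(* linearly independent over F, so their images in D2 do not vanish.          *)

(** The Nullstellensatz is [specializable_gen], an induction on generators with step
    [specializable_poly]; [exists_specialization] restates it inside [K]. By [tensor_rel_spec], a
    specialization defined on enough elements respects a given identity of tensors; by
    [spec_sum_minimal], it does not kill a shortest expression whose first coefficient survives.
    [tensor_domain] combines the two: a zero product of nonzero tensors would specialize to a zero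
    product of nonzero elements of [B]. *)

Lemma ex_min_size (T : Type) (P : seq T -> Prop) :
  (exists s, P s) -> exists2 s, P s & forall t, P t -> (size s <= size t)%N.
Proof.
move=> [s0 Ps0].
have exn : exists n, `[< exists2 s, P s & size s = n >].
  by exists (size s0); apply/asboolP; exists s0.
case: (ex_minnP exn) => n /asboolP[s Ps <-] min_s; exists s => // t Pt.
by apply: min_s; apply/asboolP; exists t.
Qed.

(** * Euclidean division and algebraic elements over a domain mapped to a field *)

Section PseudoGenerator.
Variables (A : idomainType) (K : fieldType) (ev : {rmorphism A -> K}).
Local Notation "p ^ev" := (map_poly ev p) (at level 2, format "p ^ev").

(** Otherwise dropping the leading term would shorten [f] without changing its image. *)
Lemma lead_coef_min_size (f : {poly A}) :
  f^ev != 0 ->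
  (forall g : {poly A}, g^ev = f^ev -> (size f <= size g)%N) ->
  ev (lead_coef f) != 0.
Proof.
move=> f0 min_f; apply/negP => /eqP l0.
have fn0 : (0 < size f)%N.
  by rewrite size_poly_gt0; apply: contraNneq f0 => ->; rewrite rmorph0.
have := min_f (take_poly (size f).-1 f); rewrite leqNgt.
rewrite (leq_ltn_trans (size_take_poly _ _)) ?prednK // => /(_ _)/negP[] //.
apply/polyP => i; rewrite !coef_map coef_take_poly /=.
case: ltnP => // le_i; rewrite rmorph0.
have [-> | ne_i] := eqVneq i (size f).-1; first by rewrite -lead_coefE l0.
by rewrite nth_default ?rmorph0 // -(prednK fn0) ltn_neqAle eq_sym ne_i.
Qed.

(* Euclidean division, made available over [A] by multiplying with a power of *)
(* the leading coefficient.                                                   *)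
Lemma pseudo_generator (I : {poly K} -> Prop) :
  (forall (k : A) (q f g : {poly A}), I f^ev -> I g^ev ->
    I (k *: g - q * f)^ev) ->
  (exists2 f : {poly A}, I f^ev & f^ev != 0) ->
  exists f : {poly A}, [/\ I f^ev, ev (lead_coef f) != 0,
    forall g : {poly A}, I g^ev -> exists (n : nat) (q : {poly A}),
      (lead_coef f ^+ n *: g)^ev = (q * f)^ev
    & forall g : {poly A}, I g^ev -> g^ev != 0 -> (size f <= size g^ev)%N].
Proof.
move=> Icl [f1 If1 f1n0].
have [|f0 [If f0n0] min_f] :=
  @ex_min_size A (fun s => I (Poly s)^ev /\ (Poly s)^ev != 0).
  by exists f1; rewrite polyseqK.
pose f := Poly f0.
have {}min_f g : I g^ev -> g^ev != 0 -> (size f <= size g)%N.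
  move=> Ig gn0; apply: leq_trans (size_Poly _) _.
  by apply: min_f; rewrite polyseqK.
have lf : ev (lead_coef f) != 0.
  by apply: lead_coef_min_size => // g gf; apply: min_f; rewrite gf.
have fn0 : f != 0 by apply: contraNneq lf => ->; rewrite lead_coef0 rmorph0.
exists f; split=> // [g Ig|g Ig gn0].
  exists (scalp g f), (g %/ f); rewrite Pdiv.Idomain.divp_eq rmorphD /=.
  have [->|r0] := eqVneq ((g %% f)^ev) 0; first by rewrite addr0.
  have Ir : I (g %% f)^ev.
    have -> : g %% f = lead_coef f ^+ scalp g f *: g - (g %/ f) * f.
      by rewrite Pdiv.Idomain.divp_eq addrC addKr.
    exact: Icl.
  by have := min_f _ Ir r0; rewrite leqNgt ltn_modp fn0.
(* The bound concerns the size of the image, so [g] is replaced by a shortest lift, whose leading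
   coefficient survives [ev]. *)
have [h hE <-] : exists2 h : {poly A}, h^ev = g^ev & size h = size g^ev.
  have [|h0 hE min_h] := @ex_min_size A (fun s => (Poly s)^ev = g^ev).
    by exists g; rewrite polyseqK.
  exists (Poly h0) => //; rewrite -hE size_map_poly_id0 //.
  apply: lead_coef_min_size; first by rewrite hE.
  move=> h' h'E; apply: leq_trans (size_Poly _) _; apply: min_h.
  by rewrite polyseqK h'E hE.
by apply: min_f; rewrite hE.
Qed.

Variable a : K.
Local Notation ev' := (horner_eval a \o map_poly ev).

(* If [a] is algebraic over [ev A], then every nonzero element of [ev A][a]   *)
(* divides a nonzero element of [ev A].                                       *)
Lemma algebraic_dvd_const (c : {poly A}) :
  (exists2 p : {poly A}, ev' p = 0 & p^ev != 0) -> ev' c != 0 ->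
  exists (d : {poly A}) (r : A), ev r != 0 /\ ev' (c * d) = ev r.
Proof.
move=> exp cn0.
have [k q f g /= f0 g0|p [p0 lp pK minp]] :=
    @pseudo_generator (fun p => horner_eval a p = 0) _ exp.
  rewrite rmorphB /= map_polyZ rmorphM /= linearB linearZ rmorphM /=.
  by rewrite f0 g0 !mulr0 subr0.
(* [p] is, up to a scalar, the minimal polynomial of [a]. Both [c] and [p] lie in [I], so its
   generator [f] divides them up to scalars: hence [f] does not vanish at [a], the cofactor [q] of
   [p] does, and minimality of [p] forces [f] to be constant. *)
pose I (f : {poly K}) := exists d, horner_eval a f = ev' (c * d).
have Ic : I c^ev by exists 1; rewrite mulr1.
have Icl k q f g : I f^ev -> I g^ev -> I (k *: g - q * f)^ev.
  move=> [d df] [e eg]; exists (k *: e - q * d).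
  rewrite mulrBr -scalerAr mulrCA /= !rmorphB /= !map_polyZ.
  rewrite !(rmorphM (map_poly ev)) /=.
  rewrite !linearZ /= !(rmorphM (horner_eval a)) /=.
  by rewrite df eg /= !rmorphM.
have [|f [If lf fK minf]] := pseudo_generator Icl.
  by exists c => //; apply: contraNneq cn0 => /= ->; rewrite rmorph0.
have fn0 : ev' f != 0.
  have [n [q E]] := fK c Ic; apply/eqP => /= f0.
  have /eqP := congr1 (horner_eval a) E.
  rewrite map_polyZ linearZ /= !rmorphM /= f0 mulr0 rmorphXn.
  by rewrite mulf_eq0 expf_eq0 (negPf lf) andbF; apply/negP.
have Ip : I p^ev by exists 0; rewrite mulr0 /= !rmorph0.
have [n [q E]] := fK p Ip.
have lpn : p^ev != 0.
  by rewrite -lead_coef_eq0 lead_coef_map_id0 // rmorph0.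
have q0 : ev' q = 0.
  have /eqP := congr1 (horner_eval a) E.
  rewrite map_polyZ linearZ /= p0 mulr0 !rmorphM /=.
  by rewrite eq_sym mulf_eq0 orbC (negPf fn0) => /eqP.
have ln0 : ev (lead_coef f ^+ n) != 0 by rewrite rmorphXn expf_neq0.
have /(congr1 (fun g : {poly K} => size g)) := E.
rewrite map_polyZ size_scale //= rmorphM /=.
have qn0 : q^ev != 0.
  apply: contraNneq lpn => qz; move/eqP: E.
  by rewrite map_polyZ rmorphM /= qz mul0r scaler_eq0 (negPf ln0).
have fen0 : f^ev != 0 by apply: contraNneq fn0 => /= ->; rewrite rmorph0.
rewrite size_mul // (size_map_poly_id0 lp) (size_map_poly_id0 lf).
have := minp q q0 qn0; have : (0 < size f)%N.
  by rewrite size_poly_gt0; apply: contraNneq fen0 => ->; rewrite rmorph0.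
move=> sf0 sq sE.
have sf1 : (size f <= 1)%N.
  rewrite -(leq_add2l (size q^ev)) addn1; apply: leq_trans (leqSpred _) _.
  by rewrite -sE ltnS.
have [d dE] := If; exists d, f`_0.
have fC := size1_polyC sf1.
have fev : ev' f = ev f`_0.
  by rewrite fC /= map_polyC horner_evalE hornerC coefC.
by split; [rewrite -fev | rewrite -fev; exact/esym].
Qed.

End PseudoGenerator.

(** * Specialization of finitely generated subrings to [F] *)

(** The subring [ev A] of [K] is presented by [A] and [ev]: a morphism killing the kernel of [ev]
    amounts to one on [ev A]. Prescribing [c] is what lets the induction on generators go
    through. *)
Definition specializable (F : closedFieldType) (K : fieldType)
    (A : idomainType) (j : {rmorphism F -> A}) (ev : {rmorphism A -> K}) :=
  forall c, ev c != 0 -> exists sg : {rmorphism A -> F},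
    [/\ forall k, sg (j k) = k, forall f, ev f = 0 -> sg f = 0 & sg c != 0].

Lemma specializable_poly (F : closedFieldType) (K : fieldType)
    (A : idomainType) (j : {rmorphism F -> A}) (ev : {rmorphism A -> K})
    (a : K) :
  specializable j ev ->
  specializable (polyC \o j) (horner_eval a \o map_poly ev).
Proof.
move=> sp c cn0.
have sg_map (sg : {rmorphism A -> F}) : (forall f, ev f = 0 -> sg f = 0) ->
    forall p : {poly A}, map_poly ev p = 0 -> map_poly sg p = 0.
  move=> sg0 p p0; apply/polyP => i; rewrite coef_map coef0; apply: sg0.
  by rewrite -coef_map p0 coef0.
have [alg|/forall2NP transc] := pselect (exists2 p : {poly A},
    (horner_eval a \o map_poly ev) p = 0 & map_poly ev p != 0).
- have [d [r [rn0 /= cdE]]] := algebraic_dvd_const alg cn0.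
  have [f g h k /= g0 h0|p [p0 lp pK _]] :=
      @pseudo_generator _ _ ev (fun p => horner_eval a p = 0) _ alg.
    rewrite rmorphB /= map_polyZ rmorphM /= linearB linearZ rmorphM /=.
    by rewrite g0 h0 !mulr0 subr0.
  (* If [lead_coef p] survives, division by [p] carries relations at [a] to relations at a root [al]
     of the image of [p]; if [r], a multiple of [c], survives, so does [c]. *)
  have [|sg [sgj sg0]] := sp (lead_coef p * r).
    by rewrite rmorphM mulf_neq0.
  rewrite rmorphM mulf_eq0 negb_or => /andP[sglp sgr].
  have [al /rootP al0] : exists al, root (map_poly sg p) al.
    apply/closed_rootP; rewrite size_map_poly_id0 //.
    apply: contraNneq lp => /eqP p1.
    have pC : p = (p`_0)%:P by apply: size1_polyC; rewrite (eqP p1).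
    by move: p0; rewrite pC map_polyC /= horner_evalE hornerC lead_coefC => ->.
  have ker f : (horner_eval a \o map_poly ev) f = 0 ->
      (horner_eval al \o map_poly sg) f = 0.
    move=> f0; have [n [q E]] := pK f f0.
    have : map_poly ev (lead_coef p ^+ n *: f - q * p) = 0.
      by rewrite rmorphB /= E subrr.
    move=> /(sg_map sg sg0)/(congr1 (horner_eval al)).
    rewrite rmorphB /= map_polyZ rmorphM /= linearB linearZ rmorphM /=.
    rewrite !horner_evalE al0 mulr0 subr0 horner0 => /eqP.
    by rewrite mulf_eq0 rmorphXn expf_eq0 (negPf sglp) andbF => /eqP.
  exists (horner_eval al \o map_poly sg); split=> // [k|].
    by rewrite /= map_polyC /= horner_evalE hornerC.
  apply: contraNneq sgr => c0.
  have : (horner_eval al \o map_poly sg) (c * d - r%:P) = 0.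
    apply: ker; rewrite rmorphB /= cdE map_polyC /=.
    by rewrite horner_evalE hornerC subrr.
  rewrite rmorphB rmorphM c0 mul0r /= map_polyC /= horner_evalE hornerC sub0r.
  by move/eqP; rewrite oppr_eq0.
(* Here [a] is transcendental and may go to any [al] that is not a root of the image of [c]; keeping
   one coefficient of [c] makes this image nonzero. *)
- have ker p : (horner_eval a \o map_poly ev) p = 0 -> map_poly ev p = 0.
    by move=> p0; have [//|/negP] := transc p; rewrite negbK => /eqP.
  have cev : map_poly ev c != 0.
    by apply: contraNneq cn0 => /= ->; rewrite linear0.
  have [|sg [sgj sg0 sgc]] := sp (c`_(size (map_poly ev c)).-1).
    by rewrite -coef_map -lead_coefE lead_coef_eq0.
  have /closed_nonrootP[al aln0] : map_poly sg c != 0.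
    by apply: contraNneq sgc => sc0; rewrite -coef_map sc0 coef0.
  exists (horner_eval al \o map_poly sg); split=> // [k|f f0].
    by rewrite /= map_polyC /= horner_evalE hornerC.
  by rewrite /= (sg_map _ sg0) ?ker // linear0.
Qed.

Lemma specializable_gen (F : closedFieldType) (K : fieldType)
    (i : {rmorphism F -> K}) (L : seq K) :
  exists (A : idomainType) (j : {rmorphism F -> A}) (ev : {rmorphism A -> K}),
    [/\ forall k, ev (j k) = i k, forall z, z \in L -> exists f, ev f = z
      & specializable j ev].
Proof.
elim: L => [|a L [A [j [ev [evj evL sp]]]]].
  exists F, idfun, i; split=> // c cn0; exists idfun; split=> //= [f /eqP|].
    by rewrite fmorph_eq0 => /eqP.
  by apply: contraNneq cn0 => ->; rewrite rmorph0.
exists {poly A}, (polyC \o j), (horner_eval a \o map_poly ev).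
split=> [k|z|]; last exact: specializable_poly.
  by rewrite /= map_polyC /= horner_evalE hornerC evj.
rewrite inE => /predU1P[->|/evL[f <-]].
  by exists 'X; rewrite /= map_polyX horner_evalE hornerX.
by exists f%:P; rewrite /= map_polyC /= horner_evalE hornerC.
Qed.

(* [sg] is an [F]-algebra morphism from the [F]-subalgebra [S] of [K] to [F]; *)
(* its values outside [S] are junk.                                           *)
Definition specialization (F K : fieldType) (i : {rmorphism F -> K})
    (S : K -> Prop) (sg : K -> F) :=
  [/\ forall k, S (i k) /\ sg (i k) = k,
      forall y z, S y -> S z -> S (y + z) /\ sg (y + z) = sg y + sg z
    & forall y z, S y -> S z -> S (y * z) /\ sg (y * z) = sg y * sg z].

Lemma exists_specialization (F : closedFieldType) (K : fieldType)
    (i : {rmorphism F -> K}) (L : seq K) (c : K) :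
  c \in L -> c != 0 ->
  exists S sg, [/\ specialization i S sg, forall z, z \in L -> S z & sg c != 0].
Proof.
move=> cL cn0; have [A [j [ev [evj evL sp]]]] := specializable_gen i L.
have [c' c'E] := evL c cL.
have [|sg [sgj sg0 sgc]] := sp c'; first by rewrite c'E.
pose S z := exists f, ev f = z.
pose h z := if pselect (S z) is left Sz then sg (sval (cid Sz)) else 0.
(* The choice of preimage is harmless because [sg] kills the kernel of [ev]. *)
have hE f : h (ev f) = sg f.
  rewrite /h; case: pselect => [Sz|[]]; last by exists f.
  case: cid => g /= gf; apply/eqP; rewrite -subr_eq0 -rmorphB sg0 //.
  by rewrite rmorphB gf subrr.
exists S, h; split=> //; last by rewrite -c'E hE.
split=> [k|_ _ [f <-] [g <-]|_ _ [f <-] [g <-]].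
- by rewrite -evj hE; split=> //; exists (j k).
- by split; [exists (f + g); rewrite rmorphD | rewrite -rmorphD !hE rmorphD].
- by split; [exists (f * g); rewrite rmorphM | rewrite -rmorphM !hE rmorphM].
Qed.

(** * Specializing sums of pure tensors *)

Section TensorSpecialization.
Variables (F K : fieldType) (i : {rmorphism F -> K}) (B : lmodType F).
Local Notation Ki := (restrict_scalars i K^o).
Implicit Types (s t : seq (Ki * B)) (sg : K -> F).

Definition spec_sum sg s : B := \sum_(p <- s) sg p.1 *: p.2.

(* A derivation of [tensor_rel] mentions only finitely many elements of [K]. *)
Lemma tensor_rel_spec s t : tensor_rel s t -> exists L : seq K,
  forall S sg, specialization i S sg -> (forall z, z \in L -> S z) ->
    spec_sum sg s = spec_sum sg t.
Proof.
rewrite /spec_sum.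
elim=> {s t} [s|s t _ [L HL]|s t u _ [L HL] _ [L' HL']|p s t _ [L HL]|p q s|b s
  |a a' b s|a b b' s|k a b s].
- by exists [::].
- by exists L => S sg sp SL; rewrite (HL S).
- exists (L ++ L') => S sg sp SL.
  rewrite (HL S sg sp) ?(HL' S sg sp) // => z zL; apply: SL;
    by rewrite mem_cat zL ?orbT.
- by exists L => S sg sp SL; rewrite !big_cons (HL S).
- by exists [::] => S sg sp _; rewrite !big_cons addrCA.
- exists [::] => S sg [sp _ _] _; rewrite big_cons /=.
  have := (sp 0).2; rewrite rmorph0 => E; rewrite [sg 0]E.
  by rewrite scale0r add0r.
- exists [:: a : K; a' : K] => S sg [_ sp _] SL.
  rewrite !big_cons /= addrA -scalerDl.
  by rewrite (sp _ _ _ _).2 //; apply: SL; rewrite !inE eqxx ?orbT.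
- by exists [::] => S sg _ _; rewrite !big_cons /= addrA -scalerDr.
- exists [:: a : K] => S sg [sp1 _ sp2] SL; rewrite !big_cons /= scalerA.
  have Sa : S a by apply: SL; rewrite inE.
  have := (sp2 _ _ (sp1 k).1 Sa).2; rewrite (sp1 k).2 => E.
  by rewrite [sg _]E mulrC.
Qed.

(* [s] is a shortest representative: if [spec_sum sg s] vanished, the         *)
(* [B]-components would be linearly dependent and [s] could be shortened.     *)
Lemma spec_sum_minimal (x : tensor F Ki B) : x != 0 ->
  exists s (a : K), [/\ x = \pi_(tensor F Ki B)%qT s, a != 0,
    a \in [seq (p.1 : K) | p <- s]
    & forall sg, sg a != 0 -> spec_sum sg s != 0].
Proof.
move=> xn0.
have [|s xs min_s] := @ex_min_size _
    (fun s => x = \pi_(tensor F Ki B)%qT s).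
  by exists (repr x); rewrite reprK.
case: s => [|[a b] s] in xs min_s *; first by rewrite xs eqxx in xn0.
have an0 : (a : K) != 0.
  apply/eqP => a0; suff: (size ((a, b) :: s) <= size s)%N by rewrite ltnn.
  apply: min_s; rewrite xs a0; exact/tensorP/tensor_rel_0l.
exists ((a, b) :: s), a; split=> //=; first by rewrite inE eqxx.
move=> sg sgan0; apply/eqP; rewrite /spec_sum big_cons /= => E.
(* The vanishing sum is solved for [b]; moving the scalars across the tensor sign then absorbs
   [tens a b] into the other terms. *)
pose k (p : Ki * B) : F := - (sg p.1 / sg a).
have bE : b = \sum_(p <- s) k p *: p.2.
  rewrite -[b](scalerK sgan0).
  rewrite -[X in _ *: X](addrK (\sum_(p <- s) sg p.1 *: p.2)).
  rewrite E sub0r scalerN scaler_sumr -sumrN; apply: eq_bigr => p _.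
  by rewrite scalerA -scaleNr /k mulrC.
pose s' := [seq (p.1 + k p *: a, p.2) | p <- s].
suff: (size ((a, b) :: s) <= size s')%N by rewrite size_map ltnn.
apply: min_s; rewrite xs !tensor_piE big_cons big_map /= bE.
have tens_sum r : tens a (\sum_(p <- r) k p *: p.2) =
    \sum_(p <- r) tens (k p *: a) p.2 :> tensor F Ki B.
  elim: r => [|p r IH]; last by rewrite !big_cons tensDr IH tensZ.
  by rewrite !big_nil; apply/tensorP/tensor_rel_0r.
rewrite tens_sum -big_split /=; apply: eq_bigr => p _.
by rewrite addrC tensDl.
Qed.

End TensorSpecialization.

Lemma tensor_domain (F : closedFieldType) (K : fieldType)
    (i : {rmorphism F -> K}) (B : algType F)
    (B_domain : forall b c : B, b * c = 0 -> b = 0 \/ c = 0)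
    (x y : tensor F (restrict_scalars i K^o) B) :
  x * y = 0 -> x = 0 \/ y = 0.
Proof.
move=> xy0; have [|xn0] := eqVneq x 0; first by left.
have [|yn0] := eqVneq y 0; first by right.
have [s [a [xs an0 as_ Hs]]] := spec_sum_minimal xn0.
have [t [b [yt bn0 bt Ht]]] := spec_sum_minimal yn0.
have /tensorP/tensor_rel_spec[L HL] : \pi_(tensor F _ B)%qT (seq_mul s t) =
    \pi_(tensor F (restrict_scalars i K^o) B)%qT [::].
  by rewrite -tensor_mul_pi -xs -yt; exact: xy0.
(* [L] makes the specialization respect the zero product, the components of [s] and [t] make it
   multiplicative on them, and [a * b] keeps both [a] and [b] nonzero. *)
pose L' := (a * b) :: [seq (p.1 : K) | p <- s] ++ [seq (p.1 : K) | p <- t] ++ L.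
have [||S [sg [sp SL sgn0]]] := @exists_specialization F K i L' (a * b).
- by rewrite inE eqxx.
- by rewrite mulf_neq0.
have [_ _ spM] := sp.
have Ss z : z \in [seq (p.1 : K) | p <- s] -> S z.
  by move=> zs; apply: SL; rewrite inE mem_cat zs orbT.
have St z : z \in [seq (p.1 : K) | p <- t] -> S z.
  by move=> zt; apply: SL; rewrite inE !mem_cat zt !orbT.
move: sgn0; rewrite (spM _ _ (Ss _ as_) (St _ bt)).2 mulf_eq0 negb_or.
case/andP=> sga sgb.
have := HL S sg sp _; rewrite {2}/spec_sum big_nil => /(_ _)E.
have : spec_sum sg s * spec_sum sg t = 0.
  rewrite -E; last by move=> z zL; apply: SL; rewrite inE !mem_cat zL !orbT.
  rewrite /spec_sum /seq_mul big_allpairs_dep big_distrl /=.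
  rewrite !big_seq; apply: eq_bigr => p ps; rewrite big_distrr /= !big_seq.
  apply: eq_bigr => q qt; rewrite -scalerAl -scalerAr scalerA /=.
  by congr (_ *: _); rewrite (spM _ _ _ _).2 //; [apply: Ss | apply: St];
    apply: map_f.
by case/B_domain=> /eqP;
  [rewrite (negPf (Hs _ sga)) | rewrite (negPf (Ht _ sgb))].
Qed.

Theorem lemma1p1 (F : closedFieldType) (F1 F2 : fieldType)
    (i1 : {rmorphism F -> F1}) (i2 : {rmorphism F -> F2})
    (D2 : falgType F2)
    (D2_division : forall d : D2, d != 0 -> d \is a GRing.unit)
    (D2_center : 'Z({:D2})%VS = 1%VS)
    (x y : tensor F (restrict_scalars i1 F1^o) (restrict_scalars i2 D2)) :
  x * y = 0 -> x = 0 \/ y = 0.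
Proof.
apply: tensor_domain => b c bc0.
have [|/D2_division ub] := eqVneq (b : D2) 0; first by left.
by right; apply: (mulrI ub); rewrite [LHS]bc0 mulr0.
Qed.
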